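(* Suppose that Assumption A (stated in the context) holds for the prior $\pi(\theta)$ and the true parameter $\theta_{\mathrm{true}}$. Let $k\ge 0$ and, for $\varepsilon>0$, let $n_\varepsilon$ be the smallest $n\ge 1$ such that $\overline{u_n^2}+k\,\Delta u_n^2<\varepsilon^2$. Then $$\lim_{\varepsilon\to 0}\frac{n_\varepsilon}{\varepsilon^{-2}\cdot(1+k\,\gamma)\,\mathbb{E}_{\theta\sim\pi(\theta)}[I_{\theta_0}^{-1}]}=1,$$ where $$\gamma=\frac{\left(\mathrm{Var}_{\theta\sim\pi(\theta)}(I_{\theta_0}^{-1})\right)^{1/2}}{\mathbb{E}_{\theta\sim\pi(\theta)}[I_{\theta_0}^{-1}]}.$$
   Context: Setting. For each integer $n\ge 1$ the data $\mathbf{x}_n=(x_1,\ldots,x_n)$ have a sampling distribution $p(\mathbf{x}_n|\theta)=p(x_1,\ldots,x_n|\theta)$ depending on a parameter $\theta=(\theta_0,\theta')$, where $\theta_0$ is a univariate (real) parameter of interest and $\theta'$ is a nuisance parameter that may be empty or multivariate. $\pi(\theta)$ is a prior distribution for $\theta$, and $\theta_{\mathrm{true}}=(\theta_{\mathrm{true},0},\theta_{\mathrm{true}}')$ is a fixed value in the domain of $\pi(\theta)$, treated as the true parameter. $I_\theta$ denotes the Fisher information matrix of the single-sample distribution $p(x_1|\theta)$, and $I_{\theta_0}$ denotes its first component, i.e. the diagonal entry of $I_\theta$ linked to $\theta_0$; it is a non-negative number (depending on the whole $\theta$). $I_{\theta_{\mathrm{true},0}}$ denotes this entry at $\theta=\theta_{\mathrm{true}}$.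 $I_{\theta_0}^{-1}$ and $I_{\theta_{\mathrm{true},0}}^{-1}$ are the reciprocals of these numbers. The posterior is $\pi(\theta|\mathbf{x}_n)\propto\pi(\theta)\,p(\mathbf{x}_n|\theta)$ with marginal $\pi(\theta_0|\mathbf{x}_n)$ for $\theta_0$, and the prior predictive is $m(\mathbf{x}_n)=\int p(\mathbf{x}_n|\theta)\,\pi(\theta)\,\mathrm{d}\theta$. Define $$u_n^2=\mathrm{Var}_{\theta_0\sim\pi(\theta_0|\mathbf{x}_n)}(\theta_0)\ \text{(a function of } \mathbf{x}_n),\quad \overline{u_n^2}=\mathbb{E}_{\mathbf{x}_n\sim m(\mathbf{x}_n)}[u_n^2],\quad \Delta u_n^2=\left(\mathrm{Var}_{\mathbf{x}_n\sim m(\mathbf{x}_n)}(u_n^2)\right)^{1/2}.$$ Assumption A (on $\pi(\theta)$ and $\theta_{\mathrm{true}}$): 1. $I_{\theta_0}$ is strictly positive for $\theta=\theta_{\mathrm{true}}$ and for almost every $\theta$ in the domain of $\pi(\theta)$; the second moment $\mathbb{E}_{\theta\sim\pi(\theta)}[I_{\theta_0}^{-2}]$ exists (is finite); and $\mathrm{Var}_{\theta\sim\pi(\theta)}(I_{\theta_0}^{-1})>0$. 2. It holds that $$\lim_{n\to\infty}\mathbb{E}_{\mathbf{x}_n\sim p(\mathbf{x}_n|\theta_{\mathrm{true}})}\left[\left|n\,u_n^2-I_{\theta_{\mathrm{true},0}}^{-1}\right|^2\right]=0\quad\text{and}\quad \lim_{n\to\infty}\mathbb{E}_{\theta\sim\pi(\theta)}\left[\mathbb{E}_{\mathbf{x}_n\sim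 p(\mathbf{x}_n|\theta)}\left[\left|n\,u_n^2-I_{\theta_0}^{-1}\right|^2\right]\right]=0.$$ 3. For all $n$ we have $\overline{u_n^2}>0$. *)

(* Defs.v *)
From HB Require Import structures.
From mathcomp Require Import all_boot all_order all_algebra.
From mathcomp Require Import all_classical all_reals all_analysis measurable_realfun.
Set Implicit Arguments.
Unset Strict Implicit.
Unset Printing Implicit Defensive.
Import Order.TTheory GRing.Theory Num.Theory.
Import numFieldNormedType.Exports.
Local Open Scope classical_set_scope.
Local Open Scope ring_scope.

(* The measure with density [f] with respect to [mu]. *)
Section with_density.
Local Open Scope ereal_scope.
Context d (T : measurableType d) (R : realType).
Context (mu : {measure set T -> \bar R}) (f : T -> \bar R).
Context (f_ge0 : forall x, 0 <= f x) (mf : measurable_fun [set: T] f).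

Definition with_density of (forall x, 0 <= f x) & measurable_fun [set: T] f :=
  fun A : set T => \int[mu]_(x in A) f x.

Local Notation nu := (with_density f_ge0 mf).

Let nu0 : nu set0 = 0.
Proof. by rewrite /with_density integral_set0. Qed.

Let nu_ge0 A : 0 <= nu A.
Proof. by apply: integral_ge0 => x _. Qed.

Let nu_sigma_additive : semi_sigma_additive nu.
Proof.
move=> F mF tF mUF; rewrite /with_density ge0_integral_bigcup//.
- by apply: is_cvg_nneseries => n _ _; exact: nu_ge0.
- exact: measurable_funTS.
Qed.

HB.instance Definition _ :=
  isMeasure.Build _ _ _ nu nu0 nu_ge0 nu_sigma_additive.

End with_density.

(* The library's variance is for real-valued functions; this one is for
   functions that may take the value +oo. For a nonnegative [f] it is +oo as
   soon as [f] has an infinite mean. *)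
Definition evariance d (T : measurableType d) (R : realType)
    (mu : {measure set T -> \bar R}) (f : T -> \bar R) : \bar R :=
  (\int[mu]_x (f x - \int[mu]_y f y) ^+ 2)%E.

(* Parameters theta = (theta_0, theta'), with theta' in R^q, q >= 0. *)
Definition param (R : realType) (q : nat) := q.+1.-tuple (measurableTypeR R).

(* A family of sampling densities p(x_1, ..., x_n | theta), theta in [dom],
   with respect to dominating measures on X^n. No relation between different
   sample sizes is imposed. The values of the densities at parameters outside
   [dom] are unconstrained, apart from nonnegativity and measurability (which
   can always be achieved by extending the densities by 0). *)
Record sampling_model (R : realType) (q : nat) (dX : measure_display)
    (X : measurableType dX) := SamplingModel {
  dom : set (param R q) ;
  base : forall n : nat, {sigma_finite_measure set (n.-tuple X) -> \bar R} ;
  pdf : forall n : nat, param R q -> n.-tuple X -> R ;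
  measurable_dom : measurable dom ;
  pdf_ge0 : forall n theta x, 0 <= @pdf n theta x ;
  measurable_pdf : forall n, measurable_fun [set: param R q * n.-tuple X]
    (fun z => @pdf n z.1 z.2) ;
  integral_pdf : forall n theta, (0 < n)%N -> dom theta ->
    (\int[base n]_x (@pdf n theta x)%:E = 1)%E }.

Section sampling.
Context (R : realType) (q : nat) (dX : measure_display) (X : measurableType dX).
Context (M : sampling_model R q X).
Implicit Types (n : nat) (theta : param R q).

Lemma epdf_ge0 n theta (x : n.-tuple X) : (0 <= (pdf M theta x)%:E)%E.
Proof. by rewrite lee_fin pdf_ge0. Qed.

Lemma measurable_epdf n : measurable_fun [set: param R q * n.-tuple X]
  (fun z => (pdf M z.1 z.2)%:E).
Proof. by apply/measurable_EFinP; exact: measurable_pdf. Qed.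

Lemma measurable_epdf_data n theta :
  measurable_fun [set: n.-tuple X] (fun x => (pdf M theta x)%:E).
Proof. exact: measurableT_comp (@measurable_epdf n) (pair1_measurable theta). Qed.

Lemma measurable_epdf_param n (x : n.-tuple X) :
  measurable_fun [set: param R q] (fun theta => (pdf M theta x)%:E).
Proof. exact: measurableT_comp (@measurable_epdf n) (pair2_measurable x). Qed.

Definition sampling n theta : {measure set (n.-tuple X) -> \bar R} :=
  with_density (base M n) (epdf_ge0 theta) (measurable_epdf_data theta).

Definition set_coord theta (i : 'I_q.+1) (t : R) : param R q :=
  [tuple if j == i then t else tnth theta j | j < q.+1].

(* The partial derivative of log p(x_1 | theta) with respect to theta_i. It is a
   total function, without meaning where the derivative does not exist. *)
Definition score theta (i : 'I_q.+1) (x : 1.-tuple X) : R :=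
  derive1 (fun t : R => ln (pdf M (set_coord theta i t) x)) (tnth theta i).

(* [fine] turns an infinite entry into 0: a positive diagonal entry is a finite
   one. *)
Definition fisher_info theta : 'M[R]_q.+1 :=
  \matrix_(i, j) fine (\int[sampling 1 theta]_x
                         (score theta i x * score theta j x)%:E)%E.

Definition fisher0 theta : R := fisher_info theta ord0 ord0.

(* theta |-> 1 / I_{theta_0} as a random variable under a prior on [dom]; it is
   set to 0 outside [dom], where the densities are meaningless. *)
Definition inv_fisher0 : param R q -> R :=
  (fun theta => (fisher0 theta)^-1) \_ (dom M).

End sampling.

Section bayes.
Context (R : realType) (q : nat) (dX : measure_display) (X : measurableType dX).
Context (M : sampling_model R q X) (prior : probability (param R q) R).
Implicit Types n : nat.

(* The density m(x_n) of the prior predictive distribution. *)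
Definition marginal_pdf n (x : n.-tuple X) : \bar R :=
  (\int[prior]_theta (pdf M theta x)%:E)%E.

Lemma marginal_pdf_ge0 n (x : n.-tuple X) : (0 <= marginal_pdf x)%E.
Proof. by apply: integral_ge0 => theta _; exact: (epdf_ge0 M). Qed.

Lemma measurable_marginal_pdf n :
  measurable_fun [set: n.-tuple X] (@marginal_pdf n).
Proof.
apply: (@measurable_fun_fubini_tonelli_G _ _ _ _ R prior
  (fun z : param R q * n.-tuple X => (pdf M z.1 z.2)%:E)).
- exact: measurable_epdf.
- by move=> z; exact: (epdf_ge0 M).
Qed.

Definition prior_predictive n : {measure set (n.-tuple X) -> \bar R} :=
  with_density (base M n) (@marginal_pdf_ge0 n) (@measurable_marginal_pdf n).

(* pi(theta | x_n), proportional to pi(theta) p(x_n | theta). When m(x_n) is 0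
   or +oo (an event of prior predictive probability 0) Bayes' formula is
   meaningless and [mnormalize] returns its default argument, the prior. *)
Definition posterior n (x : n.-tuple X) : probability (param R q) R :=
  mnormalize
    (with_density prior (fun theta => epdf_ge0 M theta x)
       (measurable_epdf_param M x))
    prior.

Definition coord0 (theta : param R q) : measurableTypeR R := tnth theta ord0.

Lemma measurable_coord0 : measurable_fun [set: param R q] coord0.
Proof. exact: measurable_tnth. Qed.

HB.instance Definition _ :=
  isMeasurableFun.Build _ _ _ _ coord0 measurable_coord0.

Definition posterior0 n (x : n.-tuple X) : probability (measurableTypeR R) R :=
  distribution (posterior x) coord0.

(* u_n^2, its prior predictive mean and its prior predictive standard
   deviation; all three may be +oo. *)
Definition post_var n (x : n.-tuple X) : \bar R :=
  ('V_(posterior0 x) [idfun])%E.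

Definition mean_post_var n : \bar R :=
  (\int[prior_predictive n]_x post_var x)%E.

Definition sd_post_var n : \bar R :=
  sqrte (evariance (prior_predictive n) (@post_var n)).

(* E[ |n u_n^2 - 1 / I_{theta_0}|^2 ] for x_n sampled from p(x_n | theta). *)
Definition post_var_risk n (theta : param R q) : \bar R :=
  (\int[sampling M n theta]_x
     `| n%:R%:E * post_var x - ((fisher0 M theta)^-1)%:E | ^+ 2)%E.

Record assumptionA (theta_true : param R q) : Prop := AssumptionA {
  fisher0_true_gt0 : 0 < fisher0 M theta_true ;
  fisher0_gt0 : {ae prior, forall theta, dom M theta -> 0 < fisher0 M theta} ;
  measurable_inv_fisher0 : measurable_fun [set: param R q] (inv_fisher0 M) ;
  inv_fisher0_moment2 : ('E_prior [(inv_fisher0 M ^+ 2)%R] < +oo)%E ;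
  inv_fisher0_var_gt0 : (0 < 'V_prior [inv_fisher0 M])%E ;
  risk_true_cvg0 : post_var_risk n theta_true @[n --> \oo] --> 0%E ;
  risk_prior_cvg0 :
    (\int[prior]_(theta in dom M) post_var_risk n theta)%E @[n --> \oo] --> 0%E ;
  mean_post_var_gt0 : forall n, (0 < n)%N -> (0 < mean_post_var n)%E }.

Definition admissible_size (k eps : R) (n : nat) : bool :=
  (0 < n)%N && (mean_post_var n + k%:E * sd_post_var n < (eps ^+ 2)%:E)%E.

(* The smallest admissible sample size; 0, which is never admissible, if there
   is none. *)
Definition n_eps (k eps : R) : nat :=
  match pselect (exists n, admissible_size k eps n) with
  | left ex => ex_minn ex
  | right _ => 0%N
  end.

Definition gamma : R :=
  Num.sqrt (fine 'V_prior [inv_fisher0 M]) / fine 'E_prior [inv_fisher0 M].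

End bayes.

(* Main.v *)
Require Import Defs.
From HB Require Import structures.
From mathcomp Require Import all_boot all_order all_algebra.
From mathcomp Require Import all_classical all_reals all_analysis measurable_realfun.
From mathcomp Require Import ring lra.
Set Implicit Arguments.
Unset Strict Implicit.
Unset Printing Implicit Defensive.
Import Order.TTheory GRing.Theory Num.Theory.
Import numFieldNormedType.Exports.
Local Open Scope classical_set_scope.
Local Open Scope ring_scope.

(** Write [V] for the posterior variance u_n^2, a function of the data, and [W]
    for the random variable 1 / I_{theta_0}, a function of the parameter.
    Drawing theta from the prior and then the data from p(. | theta) gives a
    joint law of the pair whose first marginal is the prior and whose second
    marginal is the prior predictive distribution. Under this joint law, the
    averaged part of Assumption A says that [n * V] converges to [W] in L^2.

    Mean and standard deviation are 1-Lipschitz for the L^2 distance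
    ([moments_close]; for the standard deviation this is the triangle inequality
    for the L^2 norm of centred variables, that is, Cauchy-Schwarz). Hence
    [n * E V] tends to [E W] and [n * sd V] to [sd W], and the criterion
    [a n = E V + k * sd V] satisfies [n * a n --> c] with
    [c = E W + k * sd W = (1 + k * gamma) * E W] ([accuracy_cvg]).

    A positive sequence equivalent to [c / n], although it need not be monotone,
    first drops below [eps ^+ 2] at an index [N] equivalent to [c / eps ^+ 2]
    ([first_passage_cvg]): [a N < eps ^+ 2] bounds [N] from below,
    [a (N - 1) >= eps ^+ 2] bounds it from above, and [N] tends to infinity
    because all the terms of the sequence are positive. Dividing by [c], which is
    positive since a nonnegative variable with positive variance has a positive
    mean, gives the claim.

    The measure-theoretic work consists in setting up the joint law
    ([integral_joint_law] and its two marginals), in the measurability of the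
    posterior variance as a function of the data ([measurable_post_var]), and in
    the possible value +oo of [V], which the L^2 bound makes negligible
    ([emoments_close]). *)

(** * Mean and standard deviation along L^2 convergence *)

Section l2.
Context d (T : measurableType d) (R : realType) (P : probability T R).
Local Open Scope ereal_scope.

Lemma Lfun2P (f : T -> R) :
  f \in Lfun P 2%:E <->
  measurable_fun [set: T] f /\ \int[P]_x ((f x) ^+ 2)%:E < +oo.
Proof.
split=> [f2|[mf fley]].
  have /integrableP[_ ley] := Lfun2_integrable_sqr f2.
  split; first by move: f2; rewrite inE => /andP[/[!inE]].
  rewrite (eq_integral (fun x => `|(f x ^+ 2)%:E|))// => x _.
  by rewrite gee0_abs ?lee_fin ?sqr_ge0.
rewrite inE; apply/andP; split; rewrite inE//=.
rewrite /finite_norm unlock /Lnorm poweR_lty//.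
rewrite (eq_integral (fun x => (f x ^+ 2)%:E))// => x _.
by rewrite /= powR_mulrn// real_normK ?num_real.
Qed.

Lemma Lfun2_Lfun1 (f : T -> R) : f \in Lfun P 2%:E -> f \in Lfun P 1.
Proof. exact: (Lfun_subset12 (fin_num_measure P _ measurableT)). Qed.

Lemma integral_variance (f : T -> R) :
  'V_P[f] = \int[P]_x ((f x - fine 'E_P[f]) ^+ 2)%:E.
Proof. by rewrite /variance unlock unlock. Qed.

(** With [D = Y - W], the hypothesis reads [V(D) + (E D)^2 <= s ^+ 2]. The second
    term bounds the difference of the means, and Cauchy-Schwarz gives
    [(sd Y - sd W)^2 <= V(D)]. *)
Lemma moments_close (Y W : T -> R) (s : R) : (0 <= s)%R ->
  Y \in Lfun P 2%:E -> W \in Lfun P 2%:E ->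
  'E_P[(Y \- W) ^+ 2] <= (s ^+ 2)%:E ->
  (`|fine 'E_P[Y] - fine 'E_P[W]| <= s)%R /\
  (`|Num.sqrt (fine 'V_P[Y]) - Num.sqrt (fine 'V_P[W])| <= s)%R.
Proof.
move=> s0 Y2 W2 YWs.
have Y1 := Lfun2_Lfun1 Y2; have W1 := Lfun2_Lfun1 W2.
have D2 : (Y \- W)%R \in Lfun P 2%:E by rewrite rpredB// lee1n.
have D1 := Lfun2_Lfun1 D2.
have VDs : 'V_P[(Y \- W)%R] + 'E_P[Y \- W] ^+ 2 <= (s ^+ 2)%:E.
  by rewrite varianceE// subeK// fin_numX ?expectation_fin_num.
have [VY VW VD] := And3 (variance_fin_num Y2) (variance_fin_num W2)
  (variance_fin_num D2).
have fV0 X : (0 <= fine 'V_P[X])%R by rewrite fine_ge0 ?variance_ge0.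
move: VDs; rewrite expectationB//.
rewrite -(fineK (expectation_fin_num Y1)) -(fineK (expectation_fin_num W1)).
rewrite -(fineK VD) -EFinB -EFin_expe -EFinD lee_fin => VDs.
split.
  rewrite -(@ler_pXn2r _ 2) ?nnegrE// real_normK ?num_real//.
  by apply: le_trans VDs; rewrite lerDr.
have cfin : covariance P Y W \is a fin_num.
  by rewrite covariance_fin_num// Lfun2_mul_Lfun1.
have eqD : fine 'V_P[(Y \- W)%R] =
    (fine 'V_P[Y] + fine 'V_P[W] - 2 * fine (covariance P Y W))%R.
  by apply: EFin_inj; rewrite EFinB EFinD EFinM !fineK// varianceB.
have := covariance_le Y2 W2.
rewrite -(fineK VY) -(fineK VW) -(fineK cfin) -EFinM lee_fin => cov_le.
rewrite -(@ler_pXn2r _ 2) ?nnegrE// real_normK ?num_real//.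
rewrite sqrrB !sqr_sqrtr ?fV0//.
apply: le_trans VDs.
rewrite eqD -mulr_natl.
have := sqr_ge0 (fine 'E_P[Y] - fine 'E_P[W])%R.
by move: cov_le; lra.
Qed.

End l2.

Lemma emeasurable_fun_sqr d (T : measurableType d) (R : realType)
    (f : T -> \bar R) :
  measurable_fun [set: T] f -> measurable_fun [set: T] (fun x => f x ^+ 2)%E.
Proof. by move=> mf; exact: emeasurable_funM. Qed.

Section extended_l2.
Context d (T : measurableType d) (R : realType) (P : probability T R).
Local Open Scope ereal_scope.

(** The variable [N * V] may take the value +oo, where the integrand of the
    hypothesis is infinite as well. A finite bound thus makes [V] finite almost
    everywhere, so that [fine] changes none of the integrals. *)
Lemma emoments_close (V : T -> \bar R) (W : T -> R) (N s : R) :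
  measurable_fun setT V -> (forall x, 0 <= V x) ->
  W \in Lfun P 2%:E -> (0 < N)%R -> (0 <= s)%R ->
  \int[P]_x `|N%:E * V x - (W x)%:E| ^+ 2 <= (s ^+ 2)%:E ->
  exists m sd : R, [/\ \int[P]_x V x = m%:E,
    sqrte (evariance P V) = sd%:E,
    (`|N * m - fine 'E_P[W]| <= s)%R &
    (`|N * sd - Num.sqrt (fine 'V_P[W])| <= s)%R].
Proof.
move=> mV V0 W2 N0 s0 risk.
have mW : measurable_fun setT W by have /Lfun2P[] := W2.
pose v x := fine (V x); pose y := (N \o* v)%R.
have mv : measurable_fun setT v by exact: measurableT_comp.
have mD : measurable_fun setT (y \- W)%R.
  by apply: measurable_funB => //; exact: measurable_funM.
have mrisk : measurable_fun setT (fun x => `|N%:E * V x - (W x)%:E| ^+ 2).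
  apply: emeasurable_fun_sqr; apply: measurableT_comp => //.
  by apply: emeasurable_funB; [exact: measurable_funeM|exact/measurable_EFinP].
have riskoo x : V x = +oo -> `|N%:E * V x - (W x)%:E| ^+ 2 = +oo.
  by move=> ->; rewrite gt0_muley ?lte_fin.
have riskE x : V x \is a fin_num ->
    `|N%:E * V x - (W x)%:E| ^+ 2 = (((y \- W) x) ^+ 2)%:E.
  move=> /fineK <-; rewrite -EFinM -EFinB abse_EFin -EFin_expe.
  by rewrite real_normK ?num_real// mulrC.
have D_le : \int[P]_x (((y \- W) x) ^+ 2)%:E <= (s ^+ 2)%:E.
  apply: le_trans risk; apply: ge0_le_integral => //.
  - by move=> x _; rewrite lee_fin sqr_ge0.
  - by apply/measurable_EFinP; exact: measurable_funX.
  - move=> x _; have [Vx|Vx] := boolP (V x \is a fin_num); first by rewrite riskE.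
    by rewrite riskoo ?leey//; move: Vx (V0 x); case: (V x).
have D2 : (y \- W)%R \in Lfun P 2%:E.
  by apply/Lfun2P; split => //; exact: le_lt_trans D_le (ltry _).
have y2 : y \in Lfun P 2%:E.
  rewrite (_ : y = (y \- W) \+ W)%R; first by rewrite rpredD// lee1n.
  by apply/funext => x /=; rewrite subrK.
have v2 : v \in Lfun P 2%:E.
  rewrite (_ : v = N^-1 \o* y)%R; first by rewrite Lfun_scale// ler1n.
  by apply/funext => x /=; rewrite mulfK// gt_eqF.
have v1 := Lfun2_Lfun1 v2.
have Vfin : {ae P, forall x, setT x -> V x = (v x)%:E}.
  have : P.-integrable setT (fun x => `|N%:E * V x - (W x)%:E| ^+ 2).
    apply/integrableP; split=> //.
    under eq_integral do rewrite gee0_abs ?expe_ge0//.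
    exact: le_lt_trans risk (ltry _).
  move/(integrable_ae measurableT); apply: filterS => x /(_ I) rfin _.
  rewrite /v fineK//; move: rfin (V0 x) (riskoo x).
  by case: (V x) => [//| |//] + _ => /[swap] ->.
have EV : \int[P]_x V x = 'E_P[v].
  rewrite unlock; apply: ae_eq_integral => //; exact/measurable_EFinP.
have Efin := expectation_fin_num v1.
have VV : evariance P V = 'V_P[v].
  rewrite /evariance EV -(fineK Efin).
  rewrite integral_variance; apply: ae_eq_integral => //.
  - by apply: emeasurable_fun_sqr; apply: emeasurable_funB.
  - by apply/measurable_EFinP; apply: measurable_funX; exact: measurable_funB.
  - by apply: filterS Vfin => x /[apply] ->; rewrite EFin_expe EFinB.
have D_leE : 'E_P[(y \- W) ^+ 2] <= (s ^+ 2)%:E by rewrite unlock.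
have [Em Vsd] := moments_close s0 y2 W2 D_leE.
exists (fine 'E_P[v]), (Num.sqrt (fine 'V_P[v])); split.
- by rewrite EV fineK.
- by rewrite VV -{1}(fineK (variance_fin_num v2)).
- by move: Em; rewrite expectationZl// fineM.
move: Vsd; rewrite varianceZ// fineM ?variance_fin_num//= sqrtrM ?sqr_ge0//.
by rewrite sqrtr_sqr (ger0_norm (ltW N0)).
Qed.

End extended_l2.

Section coupling.
Context d1 d2 (Th : measurableType d1) (X : measurableType d2) (R : realType).
Context (J : probability (Th * X)%type R) (P : probability Th R).
Context (Q : {measure set X -> \bar R}).
Local Open Scope ereal_scope.

(** Means and variances only depend on the marginals [P] and [Q], while the L^2
    distance is that of the coupling [J]. *)
Lemma coupled_moments_close (V : X -> \bar R) (W : Th -> R) (N s : R) :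
  (forall h, measurable_fun setT h -> (forall t, 0 <= h t) ->
    \int[J]_z h z.1 = \int[P]_t h t) ->
  (forall h, measurable_fun setT h -> (forall x, 0 <= h x) ->
    \int[J]_z h z.2 = \int[Q]_x h x) ->
  measurable_fun setT V -> (forall x, 0 <= V x) ->
  W \in Lfun P 2%:E -> (forall t, 0 <= W t)%R -> (0 < N)%R -> (0 <= s)%R ->
  \int[J]_z `|N%:E * V z.2 - (W z.1)%:E| ^+ 2 <= (s ^+ 2)%:E ->
  exists m sd : R, [/\ \int[Q]_x V x = m%:E,
    sqrte (evariance Q V) = sd%:E,
    (`|N * m - fine 'E_P[W]| <= s)%R &
    (`|N * sd - Num.sqrt (fine 'V_P[W])| <= s)%R].
Proof.
move=> Jfst Jsnd mV V0 W2 W0 N0 s0 risk.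
have [mW _] := (Lfun2P P W).1 W2.
have EW : 'E_J[fun z => W z.1] = 'E_P[W].
  by rewrite unlock (Jfst (fun t => (W t)%:E))//; exact/measurable_EFinP.
have VW : 'V_J[fun z => W z.1] = 'V_P[W].
  rewrite !integral_variance EW.
  apply: (Jfst (fun t => ((W t - fine 'E_P[W]) ^+ 2)%:E)).
    by apply/measurable_EFinP; apply: measurable_funX; exact: measurable_funB.
  by move=> t; rewrite lee_fin sqr_ge0.
have WJ2 : (fun z => W z.1) \in Lfun J 2%:E.
  apply/Lfun2P; split; first exact: measurableT_comp.
  rewrite (Jfst (fun t => ((W t) ^+ 2)%:E)); first by have /Lfun2P[] := W2.
  - by apply/measurable_EFinP; exact: measurable_funX.
  - by move=> t; rewrite lee_fin sqr_ge0.
have [m [sd [mE sdE Hm Hsd]]] := emoments_close (measurableT_comp mV measurable_snd)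
  (fun z => V0 z.2) WJ2 N0 s0 risk.
exists m, sd; split; rewrite -?EW -?VW -?sdE//.
  by rewrite -Jsnd.
rewrite /evariance (Jsnd V)//.
rewrite -(Jsnd (fun x => (V x - \int[Q]_y V y) ^+ 2))//.
  by apply: emeasurable_fun_sqr; exact: emeasurable_funB.
by move=> x; exact: sqre_ge0.
Qed.

End coupling.

(** A nonnegative variable of mean zero vanishes almost everywhere, hence so does
    its variance. *)
Lemma expectation_gt0 d (T : measurableType d) (R : realType)
    (P : probability T R) (W : T -> R) :
  (forall x, 0 <= W x) -> W \in Lfun P 2%:E ->
  (0 < 'V_P[W])%E -> 0 < fine 'E_P[W].
Proof.
move=> W0 W2 VW; have W1 := Lfun2_Lfun1 W2.
rewrite lt_neqAle fine_ge0 ?expectation_ge0// andbT; apply/eqP => EW.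
suff V0 : 'V_P[W]%E = 0%E by rewrite V0 ltxx in VW.
have mW : measurable_fun setT W by have /Lfun2P[] := W2.
have W_ae0 : ae_eq P setT (fun x => (W x)%:E) (cst 0%E).
  apply/(ae_eq_integral_abs P measurableT); first exact/measurable_EFinP.
  under eq_integral do rewrite gee0_abs ?lee_fin//.
  by have := fineK (expectation_fin_num W1); rewrite -EW unlock => <-.
rewrite varianceE// -(fineK (expectation_fin_num W1)) -EW.
rewrite [X in (_ - X)%E](_ : _ = 0%E) ?sube0; last by rewrite expe2 mule0.
rewrite unlock -[RHS](@integral0 _ _ _ P setT); apply: ae_eq_integral => //.
  by apply/measurable_EFinP; exact: (measurable_funX 2 mW).
apply: filterS W_ae0 => x /[apply] -[Wx].
by rewrite [(W ^+ 2) x](_ : _ = W x ^+ 2)// Wx expr0n.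
Qed.

(** * Integration against a density *)

Section density.
Context d (T : measurableType d) (R : realType).
Context (mu : {measure set T -> \bar R}) (f : T -> \bar R).
Context (f_ge0 : (forall x, 0 <= f x)%E) (mf : measurable_fun [set: T] f).
Local Open Scope ereal_scope.
Import HBNNSimple.

Local Notation nu := (with_density mu f_ge0 mf).

Let integral_with_density_nnsfun (h : {nnsfun T >-> R}) :
  \int[nu]_x (h x)%:E = \int[mu]_x ((h x)%:E * f x).
Proof.
have term_ge0 r x : 0 <= (r * \1_(h @^-1` [set r]) x)%:E.
  by rewrite EFinM nnfun_muleindic_ge0.
have mterm r : measurable_fun [set: T] (fun x => (r * \1_(h @^-1` [set r]) x)%:E).
  exact/measurable_EFinP/measurableT_comp.
transitivity (\int[nu]_x \sum_(r \in range h) (r * \1_(h @^-1` [set r]) x)%:E).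
  by apply: eq_integral => x _; rewrite fsumEFin// -fimfunE.
transitivity (\int[mu]_x \sum_(r \in range h)
    ((r * \1_(h @^-1` [set r]) x)%:E * f x)); last first.
  apply: eq_integral => x _.
  by rewrite -ge0_mule_fsuml// fsumEFin// -fimfunE.
rewrite !ge0_integral_fsum//; [|by move=> r; exact: emeasurable_funM|
  by move=> r x _; exact: mule_ge0].
apply: eq_fsbigr => r _.
have [r0|r0] := leP 0%R r; last first.
  by rewrite !integral0_eq// => x _; rewrite preimage_nnfun0// indic0 mulr0 ?mul0e.
under eq_integral do rewrite EFinM.
under [RHS]eq_integral do rewrite EFinM -muleA.
rewrite !ge0_integralZl//; last first.
- exact/measurable_EFinP.
- by move=> x _; rewrite mule_ge0.
- by apply: emeasurable_funM => //; exact/measurable_EFinP.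
rewrite integral_indic// setIT /with_density; congr (_ * _).
rewrite [LHS]integral_mkcond; apply: eq_integral => x _.
by rewrite patchE indicE; case: ifP => _; rewrite ?mul1e ?mul0e.
Qed.

(** By monotone convergence from simple functions. Where [f] is +oo, the products
    [h n x * f x] still converge to [g x * f x]: they are all zero if
    [g x = 0], and the limit is not of the form [0 * +oo] otherwise. *)
Lemma integral_with_density (g : T -> \bar R) :
  measurable_fun [set: T] g -> (forall x, 0 <= g x) ->
  \int[nu]_x g x = \int[mu]_x (g x * f x).
Proof.
move=> mg g0; pose h := nnsfun_approx measurableT mg.
have hg x : (h n x)%:E @[n --> \oo] --> g x by exact: cvg_nnsfun_approx.
have ndh x m n : (m <= n)%N -> (h m x <= h n x)%R.
  by move=> mn; exact/lefP/nd_nnsfun_approx.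
have : \int[nu]_x (h n x)%:E @[n --> \oo] --> \int[nu]_x g x.
  rewrite (eq_integral (fun x => limn (fun n => (h n x)%:E))); last first.
    by move=> x _; apply/esym/cvg_lim.
  apply: cvg_monotone_convergence => //.
  - by move=> n; exact/measurable_EFinP.
  - by move=> n x _; rewrite lee_fin.
  - by move=> x _ m n mn; rewrite lee_fin ndh.
suff : \int[nu]_x (h n x)%:E @[n --> \oo] --> \int[mu]_x (g x * f x).
  move=> h1 h2; exact: (cvg_unique _ h2 h1).
under eq_cvg do rewrite integral_with_density_nnsfun.
have hfg x : ((h n x)%:E * f x) @[n --> \oo] --> g x * f x.
  have [fx|fx] := boolP (f x \is a fin_num); first exact: cvgeZr.
  have -> : f x = +oo.
    by move: fx; move: (f_ge0 x); case: (f x).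
  have [gx0|gx0] := eqVneq (g x) 0; last first.
    apply: cvgeM => //; last exact: cvg_cst.
    by move: (g0 x) gx0; case: (g x) => [r| |]//= _ r0;
      rewrite /mule_def; case: ifPn => //.
  have h0 n : h n x = 0%R.
    apply/le_anti; rewrite fun_ge0 andbT -lee_fin [leRHS](_ : _ = g x)//.
    by rewrite /h nnsfun_approxE; exact: le_approx.
  rewrite gx0 mul0e (_ : (fun n => _) = cst 0); first exact: cvg_cst.
  by apply/funext => n; rewrite h0 mul0e.
rewrite (eq_integral (fun x => limn (fun n => (h n x)%:E * f x))); last first.
  by move=> x _; apply/esym/cvg_lim.
apply: cvg_monotone_convergence => //.
- by move=> n; apply: emeasurable_funM => //; exact/measurable_EFinP.
- by move=> n x _; rewrite mule_ge0// lee_fin.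
- by move=> x _ m n mn; rewrite lee_wpmul2r// lee_fin ndh.
Qed.

End density.

(** * The joint law of the parameter and the data *)

Lemma integral_prior_dom (R : realType) (q : nat) (dX : measure_display)
    (X : measurableType dX) (M : sampling_model R q X)
    (prior : probability (param R q) R) (f : param R q -> \bar R) :
  prior (dom M) = 1%E -> measurable_fun [set: param R q] f ->
  (forall theta, 0 <= f theta)%E ->
  (\int[prior]_(theta in dom M) f theta = \int[prior]_theta f theta)%E.
Proof.
move=> dom1 mf f0; have mdom := measurable_dom M.
have dom0 : prior (~` dom M) = 0%E.
  by rewrite probability_setC// dom1 subee.
have := ge0_negligible_integral (measurableC mdom) measurableT mf
  (fun x _ => f0 x) dom0.
by rewrite setTD setCK.
Qed.

Section joint_law.
Context (R : realType) (q : nat) (dX : measure_display) (X : measurableType dX).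
Context (M : sampling_model R q X) (prior : probability (param R q) R).
Local Open Scope ereal_scope.

Lemma measurable_integral_sampling n (g : param R q * n.-tuple X -> \bar R) :
  measurable_fun setT g -> (forall z, 0 <= g z) ->
  measurable_fun setT (fun theta => \int[sampling M n theta]_x g (theta, x)).
Proof.
move=> mg g0; under eq_fun => theta.
  rewrite integral_with_density//; last first.
    exact: measurableT_comp mg (pair1_measurable theta).
  over.
apply: (@measurable_fun_fubini_tonelli_F _ _ _ _ R (base M n)
  (fun z => g z * (pdf M z.1 z.2)%:E)).
- by apply: emeasurable_funM => //; exact: measurable_epdf.
- by move=> z; rewrite mule_ge0//; exact: (epdf_ge0 M).
Qed.

Let joint_pdf n (z : param R q * n.-tuple X) : \bar R := (pdf M z.1 z.2)%:E.

Let joint_pdf_ge0 n (z : param R q * n.-tuple X) : 0 <= joint_pdf z.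
Proof. exact: epdf_ge0. Qed.

(** The joint law of the parameter and the data. Outside [dom M] the densities
    need not have mass one, but the prior does not charge that region. *)
Definition joint_law n : {measure set (param R q * n.-tuple X) -> \bar R} :=
  with_density (prior \x base M n) (@joint_pdf_ge0 n) (@measurable_epdf _ _ _ _ M n).

Lemma integral_joint_law n (g : param R q * n.-tuple X -> \bar R) :
  measurable_fun setT g -> (forall z, 0 <= g z) ->
  \int[joint_law n]_z g z =
  \int[prior]_theta \int[sampling M n theta]_x g (theta, x).
Proof.
move=> mg g0; rewrite integral_with_density// fubini_tonelli1//=.
- apply: eq_integral => theta _; rewrite /fubini_F integral_with_density//.
  exact: measurableT_comp mg (pair1_measurable theta).
- by apply: emeasurable_funM => //; exact: measurable_epdf.
- by move=> z; rewrite mule_ge0.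
Qed.

Lemma integral_joint_law_dom n (g : param R q * n.-tuple X -> \bar R) :
  prior (dom M) = 1 -> measurable_fun setT g -> (forall z, 0 <= g z) ->
  \int[joint_law n]_z g z =
  \int[prior]_(theta in dom M) \int[sampling M n theta]_x g (theta, x).
Proof.
move=> dom1 mg g0; rewrite integral_joint_law// integral_prior_dom//.
  exact: measurable_integral_sampling.
by move=> theta; exact: integral_ge0.
Qed.

Lemma integral_joint_law_snd n (h : n.-tuple X -> \bar R) :
  measurable_fun setT h -> (forall x, 0 <= h x) ->
  \int[joint_law n]_z h z.2 = \int[prior_predictive M prior n]_x h x.
Proof.
move=> mh h0.
have mh2 := measurableT_comp mh (@measurable_snd _ _ (param R q) (n.-tuple X)).
rewrite !integral_with_density// fubini_tonelli2//=.
- apply: eq_integral => x _; rewrite /fubini_G /marginal_pdf/= ge0_integralZl//.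
  exact: measurable_epdf_param.
- by apply: emeasurable_funM => //; exact: measurable_epdf.
- by move=> z; rewrite mule_ge0.
Qed.

Lemma integral_joint_law_fst n (h : param R q -> \bar R) :
  (0 < n)%N -> prior (dom M) = 1 ->
  measurable_fun setT h -> (forall theta, 0 <= h theta) ->
  \int[joint_law n]_z h z.1 = \int[prior]_theta h theta.
Proof.
move=> n0 dom1 mh h0.
have mh1 := measurableT_comp mh (@measurable_fst _ _ (param R q) (n.-tuple X)).
rewrite (integral_joint_law_dom dom1 mh1)//=.
rewrite -[RHS](integral_prior_dom dom1)//; apply: eq_integral => theta dtheta.
rewrite integral_cst// [sampling M n theta setT](_ : _ = 1) ?mule1//.
by apply: integral_pdf => //; exact: set_mem.
Qed.

Lemma joint_law_setT n : (0 < n)%N -> prior (dom M) = 1 ->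
  joint_law n setT = 1.
Proof.
move=> n0 dom1; have := @integral_joint_law_fst n (cst 1) n0 dom1.
rewrite !integral_cst//= probability_setT !mul1e; exact.
Qed.

End joint_law.

Section joint_probability.
Context (R : realType) (q : nat) (dX : measure_display) (X : measurableType dX).
Context (M : sampling_model R q X) (prior : probability (param R q) R) (n : nat).
Context (n_gt0 : (0 < n)%N) (dom1 : prior (dom M) = 1%E).

(** The two hypotheses are arguments because they are what gives [joint_law] the
    total mass 1 that the instance below records. *)
Definition joint_probability of (0 < n)%N & prior (dom M) = 1%E :
  set (param R q * n.-tuple X) -> \bar R := joint_law M prior n.

HB.instance Definition _ := Measure.copy (joint_probability n_gt0 dom1)
  (joint_law M prior n).

HB.instance Definition _ := Measure_isProbability.Build _ _ _
  (joint_probability n_gt0 dom1) (joint_law_setT n_gt0 dom1).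

End joint_probability.

(** * Measurability of the posterior variance *)

Section posterior_variance.
Context (R : realType) (q : nat) (dX : measure_display) (X : measurableType dX).
Context (M : sampling_model R q X) (prior : probability (param R q) R) (n : nat).
Local Open Scope ereal_scope.

Let likelihood (x : n.-tuple X) : {measure set (param R q) -> \bar R} :=
  with_density prior (fun theta => epdf_ge0 M theta x)
    (measurable_epdf_param M x).

Let measurable_likelihood U :
  measurable U -> measurable_fun setT (likelihood ^~ U).
Proof.
move=> mU; rewrite /likelihood /= /with_density.
under eq_fun do rewrite integral_mkcond.
apply: (@measurable_fun_fubini_tonelli_G _ _ _ _ R prior
  (fun z : param R q * n.-tuple X => ((fun t => (pdf M t z.2)%:E) \_ U) z.1)).
  rewrite (_ : (fun z => _) = (fun z => (\1_U z.1)%:E * (pdf M z.1 z.2)%:E)).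
    apply: emeasurable_funM; last exact: measurable_epdf.
    by apply/measurable_EFinP; apply: (measurableT_comp (measurable_indic mU)).
  apply/funext => z; rewrite patchE indicE.
  by case: ifP => _; rewrite ?mul1e ?mul0e.
by move=> z; apply: erestrict_ge0 => t _; exact: epdf_ge0.
Qed.

HB.instance Definition _ := isKernel.Build _ _ _ _ R likelihood
  measurable_likelihood.

Let K : R.-pker (n.-tuple X) ~> (param R q) := knormalize likelihood prior.

Let posteriorE (x : n.-tuple X) (f : param R q -> \bar R) :
  \int[posterior M prior x]_theta f theta = \int[K x]_theta f theta.
Proof. by []. Qed.

Let integral_posterior0 (x : n.-tuple X) (f : R -> \bar R) :
  measurable_fun [set: measurableTypeR R] f -> (forall t, 0 <= f t) ->
  \int[posterior0 M prior x]_t f t =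
  \int[K x]_theta f (tnth theta ord0).
Proof.
move=> mf f0; rewrite -posteriorE.
by rewrite (@ge0_integral_distribution _ _ _ _ _ (posterior M prior x)
  (@Defs.coord0 R q)).
Qed.

Let measurable_post_mean :
  measurable_fun [set: n.-tuple X] (fun x => 'E_(posterior0 M prior x)[idfun]).
Proof.
have mid : measurable_fun [set: measurableTypeR R] (@EFin R) by exact/measurable_EFinP.
under eq_fun => x.
  rewrite unlock integralE.
  rewrite integral_posterior0//; last exact: measurable_funepos.
  rewrite integral_posterior0//; last exact: measurable_funeneg.
  over.
apply: emeasurable_funB.
- apply: (measurable_fun_integral_sfinite_kernel
    (fun z : n.-tuple X * param R q => (EFin ^\+) (tnth z.2 ord0)) K) => //.
  apply: (measurableT_comp (measurable_funepos mid)).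
  exact: (measurableT_comp (measurable_tnth _)).
- apply: (measurable_fun_integral_sfinite_kernel
    (fun z : n.-tuple X * param R q => (EFin ^\-) (tnth z.2 ord0)) K) => //.
  apply: (measurableT_comp (measurable_funeneg mid)).
  exact: (measurableT_comp (measurable_tnth _)).
Qed.

(** The posterior is a normalized kernel, so the integral over it of a
    nonnegative function of the data and the parameter is measurable in the data.
    This applies to the positive and negative parts of [theta_0], hence to the
    posterior mean [m], and then to the squared deviation from [m]. *)
Lemma measurable_post_var :
  measurable_fun [set: n.-tuple X] (fun x => post_var M prior x).
Proof.
pose m (x : n.-tuple X) := fine ('E_(posterior0 M prior x)[idfun]).
have mm : measurable_fun setT m.
  exact: (measurableT_comp _ measurable_post_mean).
rewrite (_ : (fun x => _) = (fun x => \int[K x]_theta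
    ((tnth theta ord0 - m x) ^+ 2)%:E)).
  apply: (measurable_fun_integral_sfinite_kernel
    (fun z : n.-tuple X * param R q => ((tnth z.2 ord0 - m z.1) ^+ 2)%:E) K).
    by move=> z; rewrite lee_fin sqr_ge0.
  apply/measurable_EFinP; apply: measurable_funX; apply: measurable_funB.
    exact: (measurableT_comp (measurable_tnth _)).
  exact: measurableT_comp.
apply/funext => x; rewrite /post_var integral_variance.
rewrite -(@integral_posterior0 x (fun t => ((t - m x) ^+ 2)%:E))//.
- by apply/measurable_EFinP; apply: measurable_funX; exact: measurable_funB.
- by move=> t; rewrite lee_fin sqr_ge0.
Qed.

End posterior_variance.

(** * Asymptotics of the accuracy criterion *)

Section scaling.
Context (R : realType) (q : nat) (dX : measure_display) (X : measurableType dX).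
Context (M : sampling_model R q X) (prior : probability (param R q) R).
Context (theta_true : param R q).
Context (dom1 : prior (dom M) = 1%E) (hA : assumptionA M prior theta_true).
Local Open Scope ereal_scope.

Lemma inv_fisher0_ge0 theta : (0 <= inv_fisher0 M theta)%R.
Proof.
rewrite /inv_fisher0 patchE; case: ifP => // _.
rewrite invr_ge0 /fisher0 mxE fine_ge0// integral_ge0// => x _.
by rewrite lee_fin -expr2 sqr_ge0.
Qed.

Lemma inv_fisher0_Lfun2 : inv_fisher0 M \in Lfun prior 2%:E.
Proof.
apply/Lfun2P; split; first exact: measurable_inv_fisher0 hA.
by have := inv_fisher0_moment2 hA; rewrite unlock.
Qed.

(** The averaged risk is the squared L^2 distance, under the joint law, between
    [n * u_n^2] and 1 / I_{theta_0}. *)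
Lemma post_var_concentration n (s : R) : (0 < n)%N -> (0 <= s)%R ->
  \int[prior]_(theta in dom M) post_var_risk M prior n theta <= (s ^+ 2)%:E ->
  exists m sd : R, [/\ mean_post_var M prior n = m%:E,
    sd_post_var M prior n = sd%:E,
    (`|n%:R * m - fine 'E_prior[inv_fisher0 M]| <= s)%R &
    (`|n%:R * sd - Num.sqrt (fine 'V_prior[inv_fisher0 M])| <= s)%R].
Proof.
move=> n0 s0 risk.
pose J : probability (param R q * n.-tuple X)%type R :=
  joint_probability n0 dom1.
pose g (z : param R q * n.-tuple X) :=
  `|n%:R%:E * post_var M prior z.2 - (inv_fisher0 M z.1)%:E| ^+ 2.
have mg : measurable_fun setT g.
  apply: emeasurable_fun_sqr; apply: measurableT_comp => //.
  apply: emeasurable_funB.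
    apply: measurable_funeM.
    exact: (measurableT_comp (@measurable_post_var _ _ _ _ M prior n)
      (@measurable_snd _ _ _ _)).
  apply/measurable_EFinP.
  exact: (measurableT_comp (measurable_inv_fisher0 hA) (@measurable_fst _ _ _ _)).
apply: (coupled_moments_close (J := J)) => //.
- by move=> h; exact: integral_joint_law_fst.
- by move=> h; exact: integral_joint_law_snd.
- exact: measurable_post_var.
- by move=> x; exact: variance_ge0.
- exact: inv_fisher0_Lfun2.
- exact: inv_fisher0_ge0.
- by rewrite ltr0n.
apply: le_trans risk.
rewrite [leLHS](@integral_joint_law_dom _ _ _ _ M prior n g dom1 mg); last first.
  by move=> z; exact: sqre_ge0.
rewrite le_eqVlt; apply/orP; left; apply/eqP.
apply: eq_integral => theta dtheta; apply: eq_integral => x _.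
by rewrite /g /inv_fisher0 patchE dtheta.
Qed.

End scaling.

Lemma accuracy_cvg (R : realType) (q : nat) (dX : measure_display)
    (X : measurableType dX) (M : sampling_model R q X)
    (prior : probability (param R q) R) (theta_true : param R q) (k : R) :
  prior (dom M) = 1%E -> assumptionA M prior theta_true -> 0 <= k ->
  (n%:R%:E * (mean_post_var M prior n + k%:E * sd_post_var M prior n))%E
    @[n --> \oo] -->
  (fine 'E_prior[inv_fisher0 M] +
    k * Num.sqrt (fine 'V_prior[inv_fisher0 M]))%:E.
Proof.
move=> dom1 hA k0; set EW := fine _; set SW := Num.sqrt _.
(* both moments within [e / (1 + k)] of their limits keep the sum within [e] *)
have close e : 0 < e -> \forall n \near \oo, exists2 r,
    (n%:R%:E * (mean_post_var M prior n + k%:E * sd_post_var M prior n))%E = r%:E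
    & `|EW + k * SW - r| <= e.
  move=> e0; pose s := e / (1 + k).
  have k1 : 0 < 1 + k by rewrite ltr_wpDr.
  have s0 : 0 < s by rewrite divr_gt0.
  have /fine_cvgP[rfin /cvgrPdist_le/(_ (s ^+ 2))] := risk_prior_cvg0 hA.
  rewrite exprn_gt0// => /(_ isT) rle.
  near=> n.
  have n0 : (0 < n)%N by near: n; exact: nbhs_infty_gt.
  have rs : (\int[prior]_(theta in dom M) post_var_risk M prior n theta
      <= (s ^+ 2)%:E)%E.
    rewrite -[leLHS]fineK; last by near: n.
    rewrite lee_fin; apply: le_trans (ler_norm _) _.
    by rewrite -normrN -[- _]add0r; near: n.
  have [m [sd [-> -> Hm Hsd]]] := post_var_concentration dom1 hA n0 (ltW s0) rs.
  exists (n%:R * (m + k * sd)); first by rewrite EFinM EFinD EFinM.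
  rewrite distrC.
  have -> : n%:R * (m + k * sd) - (EW + k * SW) =
      (n%:R * m - EW) + k * (n%:R * sd - SW) by ring.
  rewrite (le_trans (ler_normD _ _))// normrM (ger0_norm k0).
  have -> : e = s + k * s by rewrite -[X in X + _]mul1r -mulrDl mulrC divfK// gt_eqF.
  by rewrite lerD// ler_wpM2l.
apply/fine_cvgP; split.
  by apply: filterS (close 1 ltr01) => n [r -> _].
apply/cvgrPdist_le => e e0.
by apply: filterS (close e e0) => n [r /= -> ].
Unshelve. all: by end_near. Qed.

(** * First passage times *)

(** The sequence need not be monotone. From [a (N eps) < eps ^+ 2] comes the lower
    bound on [N eps], from minimality at its predecessor the upper bound, and
    both are sharp in the limit because [N eps] tends to infinity. *)
Lemma first_passage_cvg (R : realType) (a : nat -> \bar R) (c : R)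
    (N : R -> nat) :
  0 < c -> (forall n, (0 < n)%N -> (0 < a n)%E) ->
  (n%:R%:E * a n)%E @[n --> \oo] --> c%:E ->
  (forall eps n, (0 < n)%N -> (a n < (eps ^+ 2)%:E)%E ->
    [/\ (0 < N eps)%N, (a (N eps) < (eps ^+ 2)%:E)%E & (N eps <= n)%N]) ->
  (N eps)%:R * eps ^+ 2 @[eps --> 0^'+] --> c.
Proof.
move=> c0 a0 na Nmin.
have bounds d : 0 < d -> exists2 m, (0 < m)%N & forall n, (m <= n)%N ->
    exists2 r, a n = r%:E & c - d < n%:R * r < c + d.
  move=> d0.
  have /fine_cvgP[finna /cvgrPdist_lt /(_ _ d0) nad] := na.
  have [m _ Hm] := filterI finna nad.
  exists m.+1 => // n mn; have n0 : (0 < n)%N by exact: leq_trans mn.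
  have [/= fn dn] := Hm n (ltnW mn).
  have anfin : a n \is a fin_num.
    move: fn; move: (a0 n n0); case: (a n) => [r//| |//] _.
    by rewrite mulry gtr0_sg ?ltr0n// mul1e.
  exists (fine (a n)); first by rewrite fineK.
  by move: dn; rewrite fineM//= ltr_distlC.
(* as [a n] is eventually at most [(c + 1) / n], some term lies below any threshold *)
have reach eps : 0 < eps ->
    (0 < N eps)%N /\ (a (N eps) < (eps ^+ 2)%:E)%E.
  move=> eps0; have [m1 m10 Hm1] := bounds 1 ltr01.
  pose n := maxn m1 (Num.truncn ((c + 1) / eps ^+ 2)).+1.
  have n0 : (0 < n)%N by rewrite leq_max m10.
  suff : (a n < (eps ^+ 2)%:E)%E by move=> /(Nmin eps n n0)[].
  have [r -> /andP[_ Hr]] := Hm1 n (leq_maxl _ _).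
  rewrite lte_fin -(@ltr_pM2l _ n%:R) ?ltr0n//.
  apply: (lt_trans Hr); rewrite -ltr_pdivrMr ?exprn_gt0//.
  by apply: (lt_le_trans (truncnS_gt _)); rewrite ler_nat leq_maxr.
(* the first [m] terms are positive, so a small threshold lies below them all *)
have large m : \forall eps \near 0^'+, (m < N eps)%N.
  suff [d d0 Hd] : exists2 d : R, 0 < d &
      forall n, (0 < n)%N -> (n <= m)%N -> ((d ^+ 2)%:E <= a n)%E.
    near=> eps.
    have eps0 : 0 < eps by near: eps; exact: nbhs_right_gt.
    have epsd : eps < d by near: eps; exact: nbhs_right_lt.
    have [N0 aN] := reach eps eps0.
    rewrite ltnNge; apply/negP => Nm.
    have := le_lt_trans (Hd _ N0 Nm) aN.
    by rewrite lte_fin ltr_pXn2r ?nnegrE ?ltW// ltNge ltW.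
  elim: m => [|m [d d0 Hd]]; first by exists 1 => // n /lt0n_neq0; case: n.
  have [r r0 Hr] : exists2 r : R, 0 < r & ((r ^+ 2)%:E <= a m.+1)%E.
    move: (a0 m.+1 erefl); case: (a m.+1) => [r|_|//].
      rewrite lte_fin => r0; exists (Num.sqrt r); first by rewrite sqrtr_gt0.
      by rewrite sqr_sqrtr ?lee_fin// ltW.
    by exists 1 => //; rewrite leey.
  exists (Num.min d r) => [|n n0]; first by rewrite lt_min d0.
  have mn0 : 0 <= Num.min d r by rewrite le_min !ltW.
  rewrite leq_eqVlt => /predU1P[->|nm].
    apply: le_trans Hr; rewrite lee_fin.
    by rewrite ler_pXn2r ?nnegrE ?(ltW r0)// ge_min lexx orbT.
  apply: le_trans (Hd n n0 nm).
  by rewrite lee_fin ler_pXn2r ?nnegrE ?(ltW d0)// ge_min lexx.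
apply/cvgrPdist_lt => e e0.
have e20 : 0 < e / 2 by rewrite divr_gt0.
have [m m0 Hm] := bounds _ e20.
near=> eps.
have eps0 : 0 < eps by near: eps; exact: nbhs_right_gt.
have Nm : (m < N eps)%N by near: eps; exact: large.
have N0 : (0 < N eps)%N by exact: leq_trans Nm.
have epse : eps ^+ 2 < e / 2.
  rewrite -[ltRHS]sqr_sqrtr ?(ltW e20)// ltr_pXn2r ?nnegrE ?sqrtr_ge0 ?(ltW eps0)//.
  by near: eps; apply: nbhs_right_lt; rewrite sqrtr_gt0.
have [_ aN] := reach eps eps0.
have [r ar /andP[rc _]] := Hm _ (ltnW Nm).
have [r' ar' /andP[_ r'c]] := Hm (N eps).-1 ltac:(by rewrite -ltnS prednK).
have a'N : eps ^+ 2 <= r'.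
  rewrite leNgt -lte_fin -ar'; apply/negP => aN'.
  have N'0 : (0 < (N eps).-1)%N by rewrite (leq_trans m0)// -ltnS prednK.
  have [_ _] := Nmin _ _ N'0 aN'.
  by rewrite leqNgt prednK// leqnn.
move: aN; rewrite ar lte_fin => aN.
rewrite distrC ltr_distl; apply/andP; split.
  have : (N eps)%:R * r <= (N eps)%:R * eps ^+ 2.
    by rewrite ler_wpM2l// ltW.
  lra.
have : (N eps).-1%:R * eps ^+ 2 <= (N eps).-1%:R * r' by rewrite ler_wpM2l.
have -> : (N eps)%:R = (N eps).-1%:R + 1 :> R by rewrite natr1 prednK.
lra.
Unshelve. all: by end_near. Qed.

(** * Sample size determination *)

Theorem lemma3p4 (R : realType) (q : nat) (dX : measure_display)
    (X : measurableType dX) (M : sampling_model R q X)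
    (prior : probability (param R q) R) (theta_true : param R q) (k : R)
    (prior_dom : prior (dom M) = 1%E)
    (theta_true_dom : dom M theta_true)
    (hA : assumptionA M prior theta_true)
    (k_ge0 : 0 <= k) :
  (n_eps M prior k eps)%:R /
    (eps ^- 2 * (1 + k * gamma M prior) * fine 'E_prior [inv_fisher0 M])
    @[eps --> 0^'+] --> (1 : R).
Proof.
set EW := fine 'E_prior[inv_fisher0 M].
set SW := Num.sqrt (fine 'V_prior[inv_fisher0 M]).
have EW0 : 0 < EW.
  apply: expectation_gt0 (inv_fisher0_var_gt0 hA).
    exact: inv_fisher0_ge0.
  exact: inv_fisher0_Lfun2 hA.
pose c := EW + k * SW.
have c0 : 0 < c by rewrite ltr_wpDr// mulr_ge0// sqrtr_ge0.
have cE : (1 + k * gamma M prior) * EW = c.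
  by rewrite /gamma -/EW -/SW mulrDl mul1r mulrA mulfVK// gt_eqF.
suff lim_c : (n_eps M prior k eps)%:R * eps ^+ 2 @[eps --> 0^'+] --> c.
  rewrite (_ : (fun eps => _) =
      (fun eps : R => (n_eps M prior k eps)%:R * eps ^+ 2 / c)).
    have := cvgMr_tmp (b := c^-1) lim_c.
    by rewrite mulfV ?lt0r_neq0 // => lim1; exact: lim1.
  by apply/funext => eps; rewrite -[X in _ / X]mulrA -/EW cE invfM invrK mulrA.
apply: first_passage_cvg c0 _ (accuracy_cvg prior_dom hA k_ge0) _.
  move=> n n0; apply: (lt_le_trans (mean_post_var_gt0 hA n0)).
  by rewrite leeDl// mule_ge0 ?lee_fin// sqrte_ge0.
move=> eps n n0 an.
have an' : exists n, admissible_size M prior k eps n.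
  by exists n; rewrite /admissible_size n0.
rewrite /n_eps; case: pselect => // ex; case: ex_minnP => m /andP[m0 am] mmin.
by split=> //; apply: mmin; rewrite /admissible_size n0.
Qed.
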